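(* Let $n\ge 1$, let $\pi$ be a permutation of $\{1,\dots,n\}$, and let $C=\mathrm{Cycl}(\pi,B^n)$ be the poset of cycles of $\pi$ acting on $B^n$. For $c\in C$ let $\mathrm{Up}(c)\in\{0,1\}^C$ be the indicator vector of the set $\{x\in C: x\ge c\}$. Consider the following algorithm: start with the set $F:=\{0\}$ consisting of the zero vector of $\{0,1\}^C$; for each $c\in C$, in turn (in any order), add to $F$ the vectors $x\,|\,\mathrm{Up}(c)$ for all $x$ in the current set $F$, removing repetitions; after all $c\in C$ have been processed, return $F$. Then the returned set $F$ is $\mathrm{Fix}(\pi,D_n)$, where a fix $f\in\mathrm{Fix}(\pi,D_n)$ is identified with the vector in $\{0,1\}^C$ whose entry at a cycle $c$ is the common value of $f$ on the elements of $c$. Moreover, under this identification the partial order of $\mathrm{Fix}(\pi,D_n)$ is given by $x\le y$ if and only if $x\,|\,y=y$.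
   Context: $B=\{0,1\}$ with $0\le 1$, and $B^n$ is the set of functions $\{1,\dots,n\}\to B$ (equivalently, $n$-bit strings) with the componentwise order. $D_n$ is the set of monotone (order-preserving) functions $B^n\to B$, ordered pointwise. A permutation $\sigma$ of $\{1,\dots,n\}$ acts on $B^n$ by $\sigma(x)=x\circ\sigma$, and acts on $D_n$ by $\sigma(g)=g\circ\sigma$, i.e. $\sigma(g)(x)=g(\sigma(x))$. $\mathrm{Fix}(\sigma,D_n)=\{g\in D_n:\sigma(g)=g\}$, with the order inherited from $D_n$; a function in $D_n$ lies in $\mathrm{Fix}(\sigma,D_n)$ iff it is constant on every cycle of $\sigma$ acting on $B^n$. $\mathrm{Cycl}(\sigma,B^n)$ denotes the set of cycles (orbits, including those of length 1) of $\sigma$ acting on $B^n$, each cycle being identified with its set of elements, partially ordered by: $c\le c'$ iff there exist $x\in c$ and $y\in c'$ with $x\le y$. For vectors $x,y\in\{0,1\}^C$, $x\,|\,y$ denotes the componentwise OR. *)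

(* Defs.v *)
From HB Require Import structures.
From mathcomp Require Import all_boot all_order all_fingroup.

Set Implicit Arguments.
Unset Strict Implicit.
Unset Printing Implicit Defensive.

Import Order.TTheory.
Local Open Scope order_scope.

Section PointwiseOrder.
Variables (d : Order.disp_t) (aT : finType) (rT : porderType d).
Implicit Types f g h : {ffun aT -> rT}.

Definition lef f g := [forall x, f x <= g x].

Fact lef_refl : reflexive lef.
Proof. by move=> f; apply/forallP => x. Qed.

Fact lef_anti : antisymmetric lef.
Proof.
move=> f g /andP[/forallP fg /forallP gf]; apply/ffunP => x.
by apply/le_anti; rewrite fg gf.
Qed.

Fact lef_trans : transitive lef.
Proof.
move=> g f h /forallP fg /forallP gh; apply/forallP => x.
exact: le_trans (fg x) (gh x).
Qed.

HB.instance Definition _ :=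
  Order.Le_isPOrder.Build d {ffun aT -> rT} lef_refl lef_anti lef_trans.

Lemma lefP f g : reflect (forall x, f x <= g x) (f <= g).
Proof. exact: forallP. Qed.

End PointwiseOrder.

(* The bit strings B^n; bool carries the order false <= true. *)
Notation bits n := {ffun 'I_n -> bool}.

Section MonotoneFunctions.
Variable n : nat.

Definition monotone (g : {ffun bits n -> bool}) :=
  [forall x : bits n, forall y : bits n, (x <= y) ==> (g x <= g y)].

Lemma monotoneP (g : {ffun bits n -> bool}) :
  reflect (forall x y : bits n, x <= y -> g x <= g y) (monotone g).
Proof.
apply: (iffP forallP) => [mg x y | mg x].
  by move/forallP: (mg x) => /(_ y) /implyP.
by apply/forallP => y; apply/implyP/mg.
Qed.

(* D_n *)
Record monofun := MonoFun {
  monofun_val :> {ffun bits n -> bool};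
  monofun_monotone : monotone monofun_val }.

HB.instance Definition _ := [isSub for monofun_val].
HB.instance Definition _ := [Finite of monofun by <:].
HB.instance Definition _ :=
  [SubChoice_isSubPOrder of monofun by <: with Order.Disp tt tt].

End MonotoneFunctions.

Section Action.
Variables (n : nat) (s : 'S_n).

Definition act_bits (x : bits n) : bits n := [ffun i => x (s i)].

Fact act_bits_inj : injective act_bits.
Proof.
move=> x y /ffunP exy; apply/ffunP => i.
by have := exy (s^-1 i)%g; rewrite !ffunE permKV.
Qed.

Lemma act_bits_le x y : x <= y -> act_bits x <= act_bits y.
Proof. by move=> /lefP xy; apply/lefP => i; rewrite !ffunE. Qed.

Definition perm_bits : {perm bits n} := perm act_bits_inj.

Fact act_mono_subproof (g : monofun n) :
  monotone [ffun x => g (act_bits x)].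
Proof.
apply/monotoneP => x y xy; rewrite !ffunE.
exact/(monotoneP _ (valP g))/act_bits_le.
Qed.

Definition act_mono (g : monofun n) : monofun n :=
  MonoFun (act_mono_subproof g).

(* Fix(s, D_n), with the order inherited from D_n *)
Record fix_mono := FixMono {
  fix_mono_val :> monofun n;
  fix_mono_fixed : act_mono fix_mono_val == fix_mono_val }.

HB.instance Definition _ := [isSub for fix_mono_val].
HB.instance Definition _ := [Finite of fix_mono by <:].
HB.instance Definition _ :=
  [SubChoice_isSubPOrder of fix_mono by <: with Order.Disp tt tt].

(* Cycl(s, B^n): each cycle is its set of elements *)
Record cycl := Cycl {
  cycl_val : {set bits n};
  cycl_porbit : cycl_val \in porbits perm_bits }.

HB.instance Definition _ := [isSub for cycl_val].
HB.instance Definition _ := [Finite of cycl by <:].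

Lemma cyclP (c : cycl) : exists x, cycl_val c = porbit perm_bits x.
Proof. by case/imsetP: (valP c) => x _ ->; exists x. Qed.

Lemma cyclE (c : cycl) x : x \in cycl_val c ->
  cycl_val c = porbit perm_bits x.
Proof.
by have [y ->] := cyclP c; rewrite -eq_porbit_mem => /eqP.
Qed.

Lemma cycl_neq0 (c : cycl) : exists x, x \in cycl_val c.
Proof. by have [x ->] := cyclP c; exists x; exact: porbit_id. Qed.

Lemma cycl_eq_iter (c : cycl) x y :
    x \in cycl_val c -> y \in cycl_val c ->
  exists k, y = iter k act_bits x.
Proof.
move=> xc; rewrite (cyclE xc) => /porbitP[k ->]; exists k.
rewrite permX; elim: k => //= k ->; exact: permE.
Qed.

Lemma iter_act_le k x y : x <= y -> iter k act_bits x <= iter k act_bits y.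
Proof. by move=> xy; elim: k => //= k; apply: act_bits_le. Qed.

Lemma iter_act_cycl (c : cycl) k x : x \in cycl_val c ->
  iter k act_bits x \in cycl_val c.
Proof.
move=> xc; rewrite (cyclE xc); apply/porbitP; exists k.
by rewrite permX; elim: k => //= k <-; rewrite permE.
Qed.

Definition le_cycl (c c' : cycl) :=
  [exists x in cycl_val c, exists y in cycl_val c', x <= y].

Lemma le_cyclP (c c' : cycl) :
  reflect (exists x y, [/\ x \in cycl_val c, y \in cycl_val c' & x <= y])
          (le_cycl c c').
Proof.
apply: (iffP exists_inP) => [[x xc /exists_inP[y yc xy]]|[x [y [xc yc xy]]]].
  by exists x, y.
by exists x => //; apply/exists_inP; exists y.
Qed.

Fact le_cycl_refl : reflexive le_cycl.
Proof. by move=> c; have [x xc] := cycl_neq0 c; apply/le_cyclP; exists x, x. Qed.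

Fact le_cycl_trans : transitive le_cycl.
Proof.
move=> b a c /le_cyclP[x [y [xa yb xy]]] /le_cyclP[y' [z [y'b zc y'z]]].
have [k ey'] := cycl_eq_iter yb y'b.
apply/le_cyclP; exists (iter k act_bits x), z; split=> //.
  exact: iter_act_cycl.
by apply: le_trans y'z; rewrite ey' iter_act_le.
Qed.

Let weight (x : bits n) := (\sum_i x i)%N.

Let weight_act k x : weight (iter k act_bits x) = weight x.
Proof.
elim: k => //= k <-; rewrite /weight [RHS](reindex_inj (@perm_inj _ s)).
by apply: eq_bigr => i _; rewrite ffunE.
Qed.

Let weight_cycl (c : cycl) x y :
  x \in cycl_val c -> y \in cycl_val c -> weight x = weight y.
Proof. by move=> xc yc; have [k ->] := cycl_eq_iter xc yc; rewrite weight_act. Qed.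

Let weight_le x y : x <= y ->
  (weight x <= weight y ?= iff [forall i, x i == y i])%N.
Proof.
move=> /lefP xy; apply: leqif_sum => i _; split; first exact: xy.
by case: (x i) (y i) => [] [].
Qed.

Fact le_cycl_anti : antisymmetric le_cycl.
Proof.
move=> c c' /andP[/le_cyclP[x [y [xc yc' xy]]] /le_cyclP[y' [x' [y'c' x'c yx']]]].
have [_ exy] := weight_le xy; have [lyx _] := weight_le yx'.
have e: x = y.
  apply/ffunP => i; apply/eqP; move: i; apply/forallP; rewrite -exy eqn_leq.
  rewrite (weight_cycl yc' y'c') (weight_cycl xc x'c) lyx andbT.
  by rewrite -(weight_cycl xc x'c) -(weight_cycl yc' y'c'); case: (weight_le xy).
by apply: val_inj; rewrite /= (cyclE xc) (cyclE yc') e.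
Qed.

HB.instance Definition _ := Order.Le_isPOrder.Build (Order.Disp tt tt) cycl
  le_cycl_refl le_cycl_anti le_cycl_trans.

(* The entry at a cycle is the value of f at an arbitrarily chosen element of
   that cycle; by fix_vecE it is the common value of f on the cycle. *)
Definition fix_vec (f : fix_mono) : {ffun cycl -> bool} :=
  [ffun c : cycl => f (xchoose (cycl_neq0 c))].

Lemma fix_vecE (f : fix_mono) (c : cycl) x :
  x \in cycl_val c -> fix_vec f c = f x.
Proof.
move=> xc; rewrite ffunE; have := xchooseP (cycl_neq0 c).
move: (xchoose _) => y yc; have [k ->] := cycl_eq_iter yc xc.
elim: k => //= k ->; move: (iter k _ _) => z.
by rewrite -{1}(eqP (fix_mono_fixed f)) /= ffunE.
Qed.

Definition zero_vec : {ffun cycl -> bool} := [ffun=> false].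

Definition or_vec (v w : {ffun cycl -> bool}) : {ffun cycl -> bool} :=
  [ffun c => v c || w c].

Definition up (c : cycl) : {ffun cycl -> bool} := [ffun x => c <= x].

Definition add_cycl (F : {set {ffun cycl -> bool}}) (c : cycl) :=
  F :|: [set or_vec x (up c) | x in F].

(* cs lists the cycles in the order in which they are processed. *)
Definition fix_algorithm (cs : seq cycl) : {set {ffun cycl -> bool}} :=
  foldl add_cycl [set zero_vec] cs.

End Action.

(* Main.v *)
Require Import Defs.
From HB Require Import structures.
From mathcomp Require Import all_boot all_order all_fingroup.

(** A fix, being constant on cycles, is the same thing as a 0/1 vector indexed
    by cycles, and monotonicity of the function says exactly that the vector is
    nondecreasing on the poset of cycles ([fix_vec_nondecreasing],
    [nondecreasing_fix_vec]).  So the claim is that the algorithm returns the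
    indicators of the up-sets of that poset.

    Every returned vector is such an indicator, because the zero vector is one,
    each [up c] is one, and OR preserves them ([fix_algorithm_nondecreasing]).
    Conversely an up-set is the union of the principal up-sets of its own
    elements ([join_up_id]); whatever the processing order, the algorithm forms
    the union of any chosen family of principal up-sets, by OR-ing exactly when
    the current cycle is in the family ([join_up_in_foldl]).

    The comparison of fixes is pointwise comparison of their vectors, which for
    booleans is the equation [x | y = y]; the vectors determine the fixes
    because the cycles cover the cube. *)

Set Implicit Arguments.
Unset Strict Implicit.
Unset Printing Implicit Defensive.

Import Order.TTheory.

Lemma le_boolE (a b : bool) : (a <= b)%O = (a ==> b).
Proof. by case: a; case: b. Qed.

Section FixVectors.
Variables (n : nat) (s : 'S_n).
Implicit Types (f g : fix_mono s) (c d : cycl s) (v w : {ffun cycl s -> bool}).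

Fact cycl_of_subproof (x : bits n) :
  porbit (perm_bits s) x \in porbits (perm_bits s).
Proof. exact: imset_f. Qed.

Definition cycl_of (x : bits n) : cycl s := Cycl (cycl_of_subproof x).

Lemma mem_cycl_of x : x \in cycl_val (cycl_of x).
Proof. exact: porbit_id. Qed.

Lemma cycl_of_act x : cycl_of (act_bits s x) = cycl_of x.
Proof.
apply: val_inj; rewrite /= -(cyclE (c := cycl_of x)) //.
exact: (iter_act_cycl 1 (mem_cycl_of x)).
Qed.

Lemma cycl_of_le (x y : bits n) : (x <= y)%O -> (cycl_of x <= cycl_of y)%O.
Proof. by move=> xy; apply/le_cyclP; exists x, y; rewrite !mem_cycl_of. Qed.

Lemma fix_vec_cycl_of f x : fix_vec f (cycl_of x) = f x.
Proof. exact/fix_vecE/mem_cycl_of. Qed.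

Lemma fix_vec_inj : injective (@fix_vec n s).
Proof.
move=> f g efg; do 2!apply: val_inj; apply/ffunP => x /=.
by rewrite -!fix_vec_cycl_of efg.
Qed.

Lemma fix_le_vecP f g :
  reflect (forall c, fix_vec f c -> fix_vec g c) (f <= g)%O.
Proof.
apply: (iffP (lefP f g)) => fg => [c|x].
  have [x xc] := cycl_neq0 c; rewrite !(fix_vecE _ xc).
  by apply/implyP; rewrite -le_boolE.
by rewrite le_boolE -!fix_vec_cycl_of; apply/implyP/fg.
Qed.

Lemma or_vec_idPr v w : (forall c, v c -> w c) <-> or_vec v w = w.
Proof.
split=> [vw|<- c vc]; last by rewrite ffunE vc.
by apply/ffunP => c; rewrite ffunE; case: (v c) (vw c) => // ->.
Qed.

Definition nondecreasing_vec v := forall c d, (c <= d)%O -> v c -> v d.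

(** [c <= d] is witnessed by some comparable pair x <= y of representatives, and
    any representatives compute the entries of the vector. *)
Lemma fix_vec_nondecreasing f : nondecreasing_vec (fix_vec f).
Proof.
move=> c d /le_cyclP[x [y [xc yd xy]]].
rewrite (fix_vecE _ xc) (fix_vecE _ yd); apply/implyP; rewrite -le_boolE.
exact: (monotoneP _ (valP (val f))).
Qed.

(** The fix is [x |-> v (cycl_of x)]: it is monotone because [cycl_of] is, and
    fixed because [cycl_of] is constant on cycles. *)
Lemma nondecreasing_fix_vec v :
  nondecreasing_vec v -> exists f, v = fix_vec f.
Proof.
move=> vP.
have gP : monotone [ffun x => v (cycl_of x)].
  apply/monotoneP => x y xy; rewrite !ffunE le_boolE.
  exact/implyP/vP/cycl_of_le.
have fP : act_mono s (MonoFun gP) == MonoFun gP.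
  by apply/eqP/val_inj/ffunP => x; rewrite !ffunE cycl_of_act.
exists (FixMono fP); apply/ffunP => c; have [x xc] := cycl_neq0 c.
rewrite (fix_vecE _ xc) /= ffunE; congr (v _).
by apply: val_inj; rewrite /= (cyclE xc).
Qed.

Lemma or_up_nondecreasing v c :
  nondecreasing_vec v -> nondecreasing_vec (or_vec v (up c)).
Proof.
move=> vP a b ab; rewrite !ffunE => /orP[/(vP _ _ ab)->//|ca].
by rewrite (le_trans ca ab) orbT.
Qed.

Lemma fix_algorithm_nondecreasing cs v :
  v \in fix_algorithm cs -> nondecreasing_vec v.
Proof.
rewrite /fix_algorithm; have : {in [set zero_vec s], forall v, nondecreasing_vec v}.
  by move=> _ /set1P-> c d _; rewrite ffunE.
elim: cs [set _] v => [|c cs IH] F v FP /=; first exact: FP.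
apply: IH => w /setUP[/FP //|/imsetP[u /FP uP ->]].
exact: or_up_nondecreasing.
Qed.

(** The run of the algorithm that, starting from the single vector [w], keeps
    [x | Up(c)] when [c] is selected by [v], and [x] otherwise. *)
Definition join_up v w (cs : seq (cycl s)) :=
  foldl (fun u c => if v c then or_vec u (up c) else u) w cs.

(** Each step of the algorithm keeps both [x] and [x | Up(c)], so either choice
    made by [join_up] stays in the current set. *)
Lemma join_up_in_foldl v w (F : {set {ffun cycl s -> bool}}) cs :
  w \in F -> join_up v w cs \in foldl (@add_cycl n s) F cs.
Proof.
elim: cs w F => //= c cs IH w F wF; apply: IH.
case: ifP => _; apply/setUP; last by left.
by right; apply: (imset_f (fun x => or_vec x (up c))).
Qed.

Lemma join_upE v w cs d :
  join_up v w cs d = w d || has (fun c => v c && (c <= d)%O) cs.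
Proof.
elim: cs w => [|c cs IH] w /=; first by rewrite orbF.
by rewrite [LHS]IH; case: (v c); rewrite // !ffunE orbA.
Qed.

(** An up-set is the union of the principal up-sets of its elements. *)
Lemma join_up_id v cs : nondecreasing_vec v -> (forall c, c \in cs) ->
  join_up v (zero_vec s) cs = v.
Proof.
move=> vP cs_all; apply/ffunP => d; rewrite join_upE ffunE /=.
apply/hasP/idP => [[c _ /andP[vc cd]]|vd]; first exact: vP cd vc.
(* d itself witnesses that the chosen principal up-sets cover d *)
by exists d; rewrite ?vd ?lexx.
Qed.

Lemma fix_algorithmE cs : (forall c, c \in cs) ->
  fix_algorithm cs = [set fix_vec f | f : fix_mono s].
Proof.
move=> cs_all; apply/setP => v; apply/idP/imsetP => [|[f _ ->]].
  by move/fix_algorithm_nondecreasing/nondecreasing_fix_vec => [f ->]; exists f.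
rewrite -(join_up_id (@fix_vec_nondecreasing f) cs_all).
exact/join_up_in_foldl/set11.
Qed.

End FixVectors.

Theorem mainTheorem5 (n : nat) (pi : 'S_n) (hn : 0 < n) :
  [/\ (* the map identifying a fix with its vector is one-to-one *)
      injective (@fix_vec n pi),
      (* cs runs through all the cycles, each exactly once, in any order *)
      forall cs : seq (cycl pi), uniq cs -> (forall c, c \in cs) ->
        fix_algorithm cs = [set fix_vec f | f : fix_mono pi]
    & forall f g : fix_mono pi,
        (f <= g)%O <-> or_vec (fix_vec f) (fix_vec g) = fix_vec g].
Proof.
split; first exact: fix_vec_inj.
  by move=> cs _; apply: fix_algorithmE.
move=> f g; apply: iff_trans (or_vec_idPr _ _).
exact: iff_sym (rwP (fix_le_vecP f g)).
Qed.
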